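(* Let $\mathbb{K}$ be an algebraically closed field of characteristic zero, and let $\operatorname{r_{max}}(n,d)$ denote the maximum Waring rank of forms of degree $d$ in $n$ variables with coefficients in $\mathbb{K}$. Then for every integer $d\ge 2$, \[\operatorname{r_{max}}(3,d)\ge\left\lfloor\frac{d^2+2d+5}{4}\right\rfloor.\]
   Context: A form of degree $d$ in $n$ variables over $\mathbb{K}$ is a homogeneous polynomial of degree $d$ in $\mathbb{K}[x_1,\ldots,x_n]$. The (Waring) rank $\operatorname{rk} F$ of a form $F$ of degree $d$ is the least number $r$ such that $F$ can be written as a sum $F=\ell_1^d+\cdots+\ell_r^d$ of $d$-th powers of linear forms $\ell_1,\ldots,\ell_r$ (homogeneous polynomials of degree one in the same variables, with coefficients in $\mathbb{K}$). The quantity $\operatorname{r_{max}}(n,d)$ is the maximum of $\operatorname{rk} F$ as $F$ ranges over all forms of degree $d$ in $n$ variables over $\mathbb{K}$. *)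

(* Defs.v *)
From HB Require Import structures.
From mathcomp Require Import all_boot all_order all_algebra.
From mathcomp Require Import mpoly.

Set Implicit Arguments.
Unset Strict Implicit.
Unset Printing Implicit Defensive.

Import GRing.Theory.
Local Open Scope ring_scope.

(* [F \is d.-homog] also holds for F = 0, so the zero polynomial counts as a
   form of every degree (of rank 0) and as a linear form. *)
Definition sum_of_powers (K : fieldType) (n d : nat) (F : {mpoly K[n]})
    (r : nat) : Prop :=
  exists l : 'I_r -> {mpoly K[n]},
    (forall i, l i \is 1.-homog) /\ F = \sum_(i < r) l i ^+ d.

Definition is_waring_rank (K : fieldType) (n d : nat) (F : {mpoly K[n]})
    (r : nat) : Prop :=
  sum_of_powers d F r /\ (forall s, sum_of_powers d F s -> (r <= s)%N).

(* The existence of the rank of each form is part of the second conjunct: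
   a form that is not a sum of d-th powers would make the maximum infinite. *)
Definition is_rmax (K : fieldType) (n d m : nat) : Prop :=
  (exists F : {mpoly K[n]}, F \is d.-homog /\ is_waring_rank d F m) /\
  (forall F : {mpoly K[n]}, F \is d.-homog ->
     exists r, is_waring_rank d F r /\ (r <= m)%N).

Lemma is_waring_rank_unique (K : fieldType) (n d : nat) (F : {mpoly K[n]})
    (r s : nat) :
  is_waring_rank d F r -> is_waring_rank d F s -> r = s.
Proof.
by move=> [Dr Mr] [Ds Ms]; apply/eqP; rewrite eqn_leq (Mr _ Ds) (Ms _ Dr).
Qed.

Lemma is_rmax_unique (K : fieldType) (n d m p : nat) :
  is_rmax K n d m -> is_rmax K n d p -> m = p.
Proof.
move=> [[F [hF rF]] Mm] [[G [hG rG]] Mp]; apply/eqP; rewrite eqn_leq.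
have [r [rF' ler]] := Mp F hF; have [s [rG' les]] := Mm G hG.
by rewrite {1}(is_waring_rank_unique rF rF') ler
  {1}(is_waring_rank_unique rG rG') les.
Qed.

(* Main.v *)
Require Import Defs.
From mathcomp Require Import all_boot all_order all_algebra.
From mathcomp Require Import mpoly boolp zify ring.

(** The form x y^b z^c + G(y, z) has large enough rank, with G = y^d for d = 2b + 2,
    c = b + 1, and G = y^(d-1) z for d = 2b + 3, c = b + 2.  If such a form is
    a sum of d-th powers of linear forms, those involving x give finitely many
    weighted points of the affine plane whose moment functional L kills every
    monomial of degree at most d - 1 except y^b z^c.  Hence the (b+1)(c+1)
    monomials dividing y^b z^c are linearly independent on these points, which
    is the rank of x y^b z^c.  The moments of degree d are the coefficients of
    G corrected by the powers not involving x; as b < c they make y^(b+1), and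
    in odd degree also y^(b+1) z, independent of the previous monomials when
    there are too few powers not involving x. *)

Set Implicit Arguments.
Unset Strict Implicit.
Unset Printing Implicit Defensive.

Import GRing.Theory.
Local Open Scope ring_scope.

(** With [S] ordered by [rho], the matrix of pairings of the [f t] with the [g s] is triangular with
    nonzero diagonal, so the [f s] are linearly independent in the space of functions on [A]. *)
Lemma card_le_triangular_pairing (K : fieldType) (I S : finType) (A : {pred I})
    (f g : S -> I -> K) (rho : S -> nat) :
  (forall s, \sum_(i in A) f s i * g s i != 0) ->
  (forall s t, t != s -> (rho t <= rho s)%N ->
     \sum_(i in A) f t i * g s i = 0) ->
  (#|S| <= #|A|)%N.
Proof.
move=> diag tri.
pose M := \matrix_(s < #|S|, i < #|A|) f (enum_val s) (enum_val i).
suff /eqP <-: row_free M by apply: rank_leq_col.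
apply: inj_row_free => v vM0.
pose al s := v 0 (enum_rank s).
have rel s : \sum_t al t * \sum_(i in A) f t i * g s i = 0.
  under eq_bigr do rewrite mulr_sumr.
  rewrite exchange_big big_enum_val big1 //= => i _.
  under eq_bigr do rewrite mulrA.
  rewrite -mulr_suml (reindex_onto enum_val enum_rank) => [|s' _];
    last exact: enum_rankK.
  have := congr1 (fun u : 'rV_ _ => u 0 i) vM0; rewrite !mxE => vM0i.
  apply/eqP; rewrite mulf_eq0; apply/orP; left; apply/eqP.
  apply: etrans vM0i; apply: eq_big => [j|j _]; first by rewrite enum_valK eqxx.
  by rewrite /al enum_valK mxE.
(* Induction downwards from the largest [rho]: pairing the relation with [g s] leaves only [al s]
   and coefficients at larger [rho], already known to vanish. *)
have al0 k s : (\max_t rho t - rho s < k)%N -> al s = 0.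
  elim: k s => // k IHk s lek.
  have := rel s; rewrite (bigD1 s) //= [X in _ + X]big1 => [|t nts].
    by rewrite addr0 => /eqP; rewrite mulf_eq0 (negPf (diag s)) orbF => /eqP.
  case: (leqP (rho t) (rho s)) => [le_ts|lt_st]; first by rewrite tri ?mulr0.
  rewrite IHk ?mul0r //; have := leq_bigmax (F := rho) t; lia.
by apply/rowP=> i; rewrite mxE -[RHS](al0 _ (enum_val i) (leqnn _)) /al enum_valK.
Qed.

(** * Coefficients of powers of linear forms *)

Section PowersOfLinearForms.

Variables (K : fieldType) (n : nat).
Implicit Types (m : 'X_{1..n}) (l F : {mpoly K[n]}).

Lemma mderiv_linear_form l i : l \is 1.-homog -> l^`M(i) = (l@_U_(i))%:MP.
Proof.
move=> hl; apply/mpolyP => m; rewrite mcoeff_mderiv mcoeffC.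
have [->|nz] := eqVneq m 0%MM; first by rewrite add0m mnm0E mulr1.
rewrite mulr0 (dhomog_nemf_coeff hl) ?mul0rn //= mdegD mdeg1 addn1 eqSS.
by rewrite mdeg_eq0.
Qed.

Lemma mderiv_exp l i k :
  l \is 1.-homog -> (l ^+ k.+1)^`M(i) = (l@_U_(i) *+ k.+1) *: l ^+ k.
Proof.
move=> hl; elim: k => [|k IHk].
  by rewrite expr1 expr0 mulr1n mderiv_linear_form // -mul_mpolyC mulr1.
rewrite exprS mderivM mderiv_linear_form // IHk -scalerAr -exprS mul_mpolyC.
by rewrite -scalerDl -mulrS.
Qed.

(** The multinomial formula with denominators cleared, by induction on d: differentiate in a
    variable that occurs in [m]. *)
Lemma mcoeff_linear_form_exp l d m : l \is 1.-homog -> mdeg m = d ->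
  (l ^+ d)@_m * (\prod_i (m i)`!)%:R = d`!%:R * \prod_i l@_U_(i) ^+ m i.
Proof.
move=> hl; elim: d m => [|d IHd] m.
  move/eqP; rewrite mdeg_eq0 => /eqP ->.
  rewrite expr0 mcoeff1 eqxx fact0 !mul1r !big1 // => i _.
    by rewrite mnm0E expr0.
  by rewrite mnm0E.
move=> dm.
have [i mi_gt0] : exists i, (0 < m i)%N.
  apply/existsP; apply: contra_eqT dm => /existsPn m0.
  by rewrite mdegE big1 // => j _; apply/eqP; rewrite -leqn0 leqNgt m0.
pose m' := (m - U_(i))%MM.
have mE : m = (m' + U_(i))%MM.
  apply/mnmP => j; rewrite mnmDE mnmBE mnm1E.
  by case: eqVneq => [<-|_]; rewrite /= ?subnK ?subn0 ?addn0.
have dm' : mdeg m' = d by move: dm; rewrite mE mdegD mdeg1; lia.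
have /(congr1 (mcoeff m')) := mderiv_exp i d hl.
rewrite mcoeff_mderiv -mE mcoeffZ -[_ *+ (m' i).+1]mulr_natr => E.
have m'E j : j != i -> m j = m' j.
  by move=> nji; rewrite mE mnmDE mnm1E eq_sym (negPf nji) addn0.
have m'i : m i = (m' i).+1 by rewrite mE mnmDE mnm1E eqxx addn1.
have fE : (\prod_j (m j)`! = (m' i).+1 * \prod_j (m' j)`!)%N.
  rewrite (bigD1 i) //= [in RHS](bigD1 i) //= m'i factS mulnA.
  by congr (_ * _)%N; apply: eq_bigr => j /m'E ->.
have pE : \prod_j l@_U_(j) ^+ m j = l@_U_(i) * \prod_j l@_U_(j) ^+ m' j.
  rewrite (bigD1 i) //= [in RHS](bigD1 i) //= m'i exprS mulrA.
  by congr (_ * _); apply: eq_bigr => j /m'E ->.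
rewrite fE pE natrM mulrA E -mulrA IHd // factS natrM.
by rewrite -[l@_U_(i) *+ _]mulr_natl -!mulrA; congr (_ * _); rewrite mulrCA.
Qed.

Lemma mcoeff_sum_of_powers d r (l : 'I_r -> {mpoly K[n]}) F m :
  (forall i, l i \is 1.-homog) -> F = \sum_(i < r) l i ^+ d -> mdeg m = d ->
  F@_m * (\prod_j (m j)`!)%:R = d`!%:R * \sum_i \prod_j (l i)@_U_(j) ^+ m j.
Proof.
move=> hl -> dm; rewrite raddf_sum mulr_suml mulr_sumr /=.
by apply: eq_bigr => i _; apply: mcoeff_linear_form_exp.
Qed.

End PowersOfLinearForms.

(** * Every form is a sum of powers *)

Lemma base_expansion_ltn B n (f : 'I_n -> nat) :
  (forall i, (f i < B)%N) -> (\sum_(i < n) f i * B ^ i < B ^ n)%N.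
Proof.
elim: n f => [|n IHn] f ltf; first by rewrite big_ord0.
rewrite big_ord_recr /=.
have := IHn (fun i => f (widen_ord (leqnSn n) i)) (fun i => ltf _).
rewrite -(ltn_add2r (f ord_max * B ^ n)) => /leq_trans; apply.
by rewrite -mulSn expnS leq_mul2r ltf orbT.
Qed.

Lemma base_expansion_inj B n (f g : 'I_n -> nat) :
  (forall i, (f i < B)%N) -> (forall i, (g i < B)%N) ->
  (\sum_(i < n) f i * B ^ i = \sum_(i < n) g i * B ^ i)%N -> f =1 g.
Proof.
elim: n f g => [|n IHn] f g ltf ltg; first by move=> _ [].
have recl (h : 'I_n.+1 -> nat) : (\sum_(i < n.+1) h i * B ^ i =
    (\sum_(i < n) h (lift ord0 i) * B ^ i) * B + h ord0)%N.
  rewrite big_ord_recl expn0 muln1 addnC big_distrl /=; congr (_ + _)%N.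
  by apply: eq_bigr => i _; rewrite /bump /= add1n expnSr mulnA.
have B_gt0 : (0 < B)%N by apply: leq_trans (ltf ord0).
rewrite !recl => E.
have E0 : f ord0 = g ord0.
  by have := congr1 (modn^~ B) E; rewrite !modnMDl !modn_small.
move: E; rewrite E0 => /addIn /eqP; rewrite eqn_pmul2r // => /eqP E.
move=> i; case: (unliftP ord0 i) => [j ->|-> //].
exact: (IHn (fun j => f (lift ord0 j)) (fun j => g (lift ord0 j))).
Qed.

Lemma closed_field_root (K : closedFieldType) d (c : K) :
  (0 < d)%N -> exists r, r ^+ d = c.
Proof.
move=> d_gt0; have [r rE] := solve_monicpoly (fun i => c *+ (i == 0%N)) d_gt0.
exists r; rewrite rE (bigD1 (Ordinal d_gt0)) //= expr0 mulr1 big1 ?addr0 //.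
by move=> i; rewrite -val_eqE /= => /negPf ->; rewrite mul0r.
Qed.

Lemma linear_form_homog (R : comNzRingType) n (a : 'I_n -> R) :
  \sum_i a i *: 'X_i \is [in R[n], 1.-homog].
Proof.
by apply: rpred_sum => i _; apply: rpredZ; rewrite dhomogX /= mdeg1.
Qed.

Lemma mcoeff_linear_form (R : comNzRingType) n (a : 'I_n -> R) i :
  (\sum_j a j *: 'X_j)@_U_(i) = a i.
Proof.
rewrite raddf_sum (bigD1 i) //= mcoeffZ mcoeffX eqxx mulr1 big1 ?addr0 //.
move=> j nji; rewrite mcoeffZ mcoeffX.
by rewrite (_ : _ == _ = false) ?mulr0 //; apply: contraNF nji => /eqP/mnmP/(_ i);
   rewrite !mnm1E eqxx; case: eqVneq.
Qed.

(* The linear forms are taken on the curve t |-> (t^((d+1)^i))_i: on it distinct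
   monomials of degree d restrict to distinct powers of t, so that a
   Vandermonde matrix gives the coefficients. *)
Lemma dhomog_sum_of_powers (K : closedFieldType) n d (F : {mpoly K[n]}) :
  [pchar K] =i pred0 -> (0 < d)%N -> F \is d.-homog ->
  sum_of_powers d F (d.+1 ^ n).
Proof.
move=> charK0 d_gt0 hF; set D := (d.+1 ^ n)%N.
have natr_neq0 k : (0 < k)%N -> k%:R != 0 :> K.
  by move=> k_gt0; rewrite (proj1 (pcharf0P K) charK0) -lt0n.
pose a := \row_(t < D) (t%:R : K).
have Vunit : Vandermonde D a \in unitmx.
  rewrite unitmxE det_Vandermonde unitfE; apply/prodf_neq0 => i _.
  apply/prodf_neq0 => j lt_ij; rewrite !mxE -natrB ?natr_neq0 ?subn_gt0 //.
  exact: ltnW.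
pose code (m : 'X_{1..n}) := (\sum_(i < n) m i * d.+1 ^ i)%N.
have bnd (m : 'X_{1..n}) i : (mdeg m < d.+1)%N -> (m i < d.+1)%N.
  apply: leq_ltn_trans.
  by rewrite mdegE (bigD1 i) //= leq_addr.
(* Each sum has at most one term, as [code] is injective on exponents at most d. The weights [gam]
   then have these entries as power sums, and their d-th roots are absorbed into the linear
   forms. *)
pose phi := \col_(e < D) \sum_(m : 'X_{1..n < d.+1} | code m == e)
  F@_m * (\prod_i (m i)`!)%:R / d`!%:R.
pose gam := invmx (Vandermonde D a) *m phi.
have gamE (m : 'X_{1..n}) : mdeg m = d ->
    \sum_(t < D) gam t 0 * t%:R ^+ code m = F@_m * (\prod_i (m i)`!)%:R / d`!%:R.
  move=> dm; have lt_m : (mdeg m < d.+1)%N by rewrite dm.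
  have lt_code : (code m < D)%N.
    by apply: base_expansion_ltn => i; apply: bnd.
  have := mulKVmx Vunit phi => /matrixP/(_ (Ordinal lt_code) 0).
  rewrite -/gam !mxE (bigD1 (BMultinom lt_m)) //= [X in _ + X]big1 ?addr0 => [<-|m'].
    by apply: eq_bigr => t _; rewrite !mxE mulrC.
  case/andP=> /eqP cE /negP[]; apply/eqP/val_inj/mnmP => /=.
  by apply: base_expansion_inj cE => i; apply: bnd => //; apply: bmdeg.
have [rt rtE] : exists rt : 'I_D -> K, forall t, rt t ^+ d = gam t 0.
  have rtP t := closed_field_root (gam t 0) d_gt0.
  by exists (fun t => projT1 (cid (rtP t))) => t; case: cid.
pose l (t : 'I_D) : {mpoly K[n]} :=
  \sum_(i < n) (rt t * t%:R ^+ (d.+1 ^ i)) *: 'X_i.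
have hl t : l t \is 1.-homog by apply: linear_form_homog.
exists l; split=> //; apply/mpolyP => m.
have [dm|ndm] := eqVneq (mdeg m) d; last first.
  have hS : \sum_(t < D) l t ^+ d \is d.-homog.
    by apply: rpred_sum => t _; have := dhomogMn d (hl t); rewrite mul1n.
  by rewrite (dhomog_nemf_coeff hF) ?(dhomog_nemf_coeff hS).
have mf_neq0 : (\prod_i (m i)`!)%:R != 0 :> K.
  by apply: natr_neq0; apply: prodn_gt0 => i; apply: fact_gt0.
apply: (mulIf mf_neq0); rewrite (mcoeff_sum_of_powers hl erefl dm).
rewrite (_ : \sum_i _ = \sum_(t < D) gam t 0 * t%:R ^+ code m).
  by rewrite gamE // [RHS]mulrC divfK // natr_neq0 ?fact_gt0.
apply: eq_bigr => t _; rewrite -rtE -[in RHS]dm mdegE -!prodrXr -big_split /=.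
apply: eq_bigr => i _; rewrite mcoeff_linear_form exprMn -exprM.
by rewrite mulnC.
Qed.

(** * Moments of weighted points in the plane *)

Section Moments.

Variables (K : fieldType) (I : finType) (A : {pred I}) (w y z : I -> K).

Definition moment j k := \sum_(i in A) w i * y i ^+ j * z i ^+ k.

(* The monomials y^j z^k with j <= b, k <= c and y^(b+1) z^i with i < e are
   linearly independent on A: they are paired by the moment functional with
   y^(b-j) z^(c-k) and y^(p i) z^(q i), and the pairing is triangular for the
   degree, the extra monomials coming first within each degree. *)
Lemma card_ge_of_moments b c e (p q : nat -> nat) :
  moment b c != 0 ->
  (forall j k, (j + k <= b + c)%N -> (j, k) != (b, c) -> moment j k = 0) ->
  (forall i, (i < e)%N -> [/\ (b < p i)%N, (p i + q i + i = c)%N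
     & moment (b.+1 + p i) (i + q i) != 0]) ->
  (b.+1 * c.+1 + e <= #|A|)%N.
Proof.
move=> Lbc Lz Le.
pose S : finType := ('I_b.+1 * 'I_c.+1 + 'I_e)%type.
pose fy (s : S) := match s with inl jk => nat_of_ord jk.1 | inr _ => b.+1 end.
pose fz (s : S) := match s with inl jk => nat_of_ord jk.2 | inr i => i end.
pose gy (s : S) := match s with inl jk => (b - jk.1)%N | inr i => p i end.
pose gz (s : S) := match s with inl jk => (c - jk.2)%N | inr i => q i end.
pose rho (s : S) := match s with
  inl jk => (jk.1 + jk.2).*2.+1 | inr i => (b.+1 + i).*2 end.
have pairE s t : \sum_(i in A) (y i ^+ fy t * z i ^+ fz t) *
    (w i * y i ^+ gy s * z i ^+ gz s) = moment (fy t + gy s) (fz t + gz s).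
  apply: eq_bigr => i _; rewrite !exprD; ring.
have -> : (b.+1 * c.+1 + e = #|S|)%N by rewrite card_sum card_prod !card_ord.
apply: (@card_le_triangular_pairing _ _ _ _
  (fun s i => y i ^+ fy s * z i ^+ fz s)
  (fun s i => w i * y i ^+ gy s * z i ^+ gz s) rho) => [s|s t nts].
  rewrite pairE; case: s => [[j k]|i] /=.
    by have [? ?] := (ltn_ord j, ltn_ord k); rewrite !subnKC.
  by have [] := Le i (ltn_ord i).
rewrite pairE => le_ts; apply: Lz; rewrite ?xpair_eqE.
- case: s t nts le_ts => [[j k]|i] [[j' k']|i'] //= nts le_ts.
  + by have [? ?] := (ltn_ord j, ltn_ord k); lia.
  + by have [? ?] := (ltn_ord j, ltn_ord k); lia.
  + by have [? ? _] := Le i (ltn_ord i); lia.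
  + have [? ? _] := Le i (ltn_ord i).
    have : (i' : nat) != i by apply: contraNneq nts => /val_inj ->.
    lia.
(* If [s] or [t] is an extra monomial, the exponent of y in the product exceeds b; otherwise the
   product is y^b z^c only for [s] = [t]. *)
- apply: contraNN nts; case: s t le_ts => [[j k]|i] [[j' k']|i'] //= le_ts E.
  + have [? ?] := (ltn_ord j, ltn_ord k); have [? ?] := (ltn_ord j', ltn_ord k').
    have [Ej Ek] : j' = j :> nat /\ k' = k :> nat by lia.
    by rewrite (val_inj Ej) (val_inj Ek).
  + by lia.
  + by have [? ? _] := Le i (ltn_ord i); lia.
  + by have [? ? _] := Le i (ltn_ord i); lia.
Qed.

End Moments.

(** * From a decomposition to its moments *)

Definition mon3 i j k : 'X_{1..3} := [multinom [tuple i; j; k]].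

Lemma mon3_eq i j k i' j' k' :
  (mon3 i j k == mon3 i' j' k') = [&& i == i', j == j' & k == k'].
Proof. by rewrite -val_eqE /= -val_eqE /= !eqseq_cons andbT. Qed.

Lemma mdeg_mon3 i j k : mdeg (mon3 i j k) = (i + j + k)%N.
Proof. by rewrite mdegE !big_ord_recr big_ord0. Qed.

(* [u i] and [v i] are the last two coefficients of the i-th linear form; it
   belongs to [A] when its first coefficient is nonzero. *)
Lemma sum_of_powers_moments (K : fieldType) b c p q r :
  [pchar K] =i pred0 -> (p + q = b + c.+1)%N ->
  sum_of_powers (b + c.+1)
    ('X_[mon3 1 b c] + 'X_[mon3 0 p q] : {mpoly K[3]}) r ->
  exists (A : {set 'I_r}) (w y z u v : 'I_r -> K),
  [/\ moment (mem A) w y z b c != 0,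
    forall j k, (j + k <= b + c)%N -> (j, k) != (b, c) ->
      moment (mem A) w y z j k = 0 &
    forall j k, (j + k = b + c.+1)%N ->
      (moment (mem A) w y z j k + \sum_(i in ~: A) u i ^+ j * v i ^+ k == 0)
      = ((j, k) != (p, q))].
Proof.
move=> charK0 pq [l [hl FE]]; set d := (b + c.+1)%N in FE *.
have natr_eq0 := proj1 (pcharf0P K) charK0.
pose o1 : 'I_3 := lift ord0 ord0; pose o2 : 'I_3 := lift ord0 (lift ord0 ord0).
pose x i := (l i)@_U_(ord0); pose u i := (l i)@_U_(o1); pose v i := (l i)@_U_(o2).
pose A := [set i | x i != 0].
pose mu j k := \sum_i x i ^+ (d - (j + k)) * u i ^+ j * v i ^+ k.
(* Up to a nonzero factor, [mu j k] is the coefficient of the form at x^(d-j-k) y^j z^k. *)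
have muE j k : (j + k <= d)%N -> (mu j k == 0) =
    ~~ ((d == (j + k).+1) && ((j, k) == (b, c)) || ((j, k) == (p, q))).
  move=> le_d.
  have dm : mdeg (mon3 (d - (j + k)) j k) = d by rewrite mdeg_mon3; lia.
  have := mcoeff_sum_of_powers hl FE dm.
  under [X in _ = _ * X]eq_bigr do rewrite !big_ord_recl big_ord0 mulr1 mulrA.
  rewrite -[X in _ = _ * X]/(mu j k) => muF.
  have dfact : d`!%:R != 0 :> K by rewrite natr_eq0 -lt0n fact_gt0.
  rewrite -(mulrI_eq0 _ (mulfI dfact)) -muF mulf_eq0 natr_eq0.
  rewrite (negPf (_ : (\prod_i _)%N != 0%N)) ?orbF; last first.
    by rewrite -lt0n; apply: prodn_gt0 => i; apply: fact_gt0.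
  rewrite mcoeffD !mcoeffX !mon3_eq -natrD natr_eq0 !xpair_eqE; lia.
(* Scaling the first coefficient to 1 turns a form involving x into an affine point, with weight the
   d-th power of that coefficient. *)
pose w i := x i ^+ d; pose y i := u i / x i; pose z i := v i / x i.
(* The power of 0 is 1 for j + k = d and 0 below, so the forms without x affect only the moments of
   degree d. *)
have muA j k : (j + k <= d)%N -> mu j k = moment (mem A) w y z j k +
    \sum_(i in ~: A) (0 ^+ (d - (j + k))) * (u i ^+ j * v i ^+ k).
  move=> le_d; rewrite /mu (bigID (mem A)) /=; congr (_ + _).
    apply: eq_bigr => i; rewrite inE => xi.
    rewrite !expr_div_n /w -[in RHS](subnK le_d) !exprD.
    by field; rewrite !expf_neq0.
  apply: eq_big => i; first by rewrite !inE.
  by rewrite inE negbK => /eqP ->; rewrite mulrA.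
have LE j k : (j + k <= b + c)%N -> moment (mem A) w y z j k = mu j k.
  move=> le_jk; rewrite muA; last by rewrite /d; lia.
  rewrite big1 ?addr0 // => i _; rewrite expr0n.
  by rewrite (_ : _ == _ = false) ?mul0r //; apply/eqP; rewrite /d; lia.
exists A, w, y, z, u, v; split=> [|j k le_jk njk|j k jkE].
- by rewrite LE // muE /d ?xpair_eqE ?eqxx ?addnS ?eqxx // ltnW.
- apply/eqP; rewrite LE // muE /d; last by lia.
  by rewrite (negPf njk) andbF /= xpair_eqE; lia.
- have := muA j k; rewrite jkE subnn => /(_ (leqnn _)).
  under eq_bigr do rewrite expr0 mul1r.
  by move=> <-; rewrite muE ?jkE // -/d (_ : d == d.+1 = false) //; lia.
Qed.

(** * Existence of the maximum rank *)

Lemma waring_rank_exists (K : fieldType) n d (F : {mpoly K[n]}) s :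
  sum_of_powers d F s -> exists r, is_waring_rank d F r /\ (r <= s)%N.
Proof.
move=> Fs; have exF : exists r, `[< sum_of_powers d F r >].
  by exists s; apply/asboolP.
case: (ex_minnP exF) => r /asboolP Fr rmin; exists r.
by split; [split=> // t /asboolP /rmin | apply/rmin/asboolP].
Qed.

(** The bound [d.+1 ^ n] on the number of powers is uniform in the form, so the ranks have a
    maximum. *)
Lemma rmax_exists (K : closedFieldType) n d :
  [pchar K] =i pred0 -> (0 < d)%N -> exists m, is_rmax K n d m.
Proof.
move=> charK0 d_gt0.
have rk (F : {mpoly K[n]}) : F \is d.-homog ->
    exists r, is_waring_rank d F r /\ (r <= d.+1 ^ n)%N.
  by move=> hF; apply: waring_rank_exists; apply: dhomog_sum_of_powers.
pose P m := `[< exists F : {mpoly K[n]}, F \is d.-homog /\ is_waring_rank d F m >].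
have exP : exists m, P m.
  have [r [r0 _]] := rk 0 (dhomog0 _ _ _).
  by exists r; apply/asboolP; exists 0; split=> //; apply: dhomog0.
have ubP m : P m -> (m <= d.+1 ^ n)%N.
  move=> /asboolP [F [hF [_ Fmin]]].
  by apply: Fmin; apply: dhomog_sum_of_powers.
case: (ex_maxnP exP ubP) => m /asboolP Pm mmax; exists m; split=> // F hF.
have [r [Fr _]] := rk F hF; exists r; split=> //.
by apply: mmax; apply/asboolP; exists F.
Qed.

(** * Lower bounds in even and odd degree *)

Lemma even_degree_rank_ge (K : fieldType) b r :
  [pchar K] =i pred0 ->
  sum_of_powers (b + b.+2)
    ('X_[mon3 1 b b.+1] + 'X_[mon3 0 (b + b.+2) 0] : {mpoly K[3]}) r ->
  (b.+1 * b.+2 + 1 <= r)%N.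
Proof.
move=> charK0 /(sum_of_powers_moments charK0 (addn0 _)).
case=> A [w [y [z [u [v [Lbc L0 Ld]]]]]].
have rE : (#|A| + #|~: A| = r)%N by rewrite cardsC card_ord.
(* A power without x supplies the extra 1. If there is none, the moment of y^d is nonzero, and
   y^(b+1) paired with itself is an extra independent monomial. *)
have [A0|[i Ai]] := set_0Vmem (~: A); last first.
  have : (0 < #|~: A|)%N by apply/card_gt0P; exists i.
  have : (b.+1 * b.+2 + 0 <= #|A|)%N.
    exact: (card_ge_of_moments (p := id) (q := id) Lbc L0).
  lia.
rewrite -rE A0 cards0 addn0.
apply: (card_ge_of_moments (p := fun=> b.+1) (q := fun=> 0%N) Lbc L0) => -[|//] _.
split; rewrite ?addn0 // addSnnS.
have := Ld (b + b.+2)%N 0%N (addn0 _).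
by rewrite A0 big_set0 addr0 eqxx /= => /negbT.
Qed.

Lemma odd_degree_rank_ge (K : fieldType) b r :
  [pchar K] =i pred0 ->
  sum_of_powers (b + b.+3)
    ('X_[mon3 1 b b.+2] + 'X_[mon3 0 (b + b.+2) 1] : {mpoly K[3]}) r ->
  (b.+1 * b.+3 + 2 <= r)%N.
Proof.
move=> charK0 /sum_of_powers_moments.
have pq : (b + b.+2 + 1 = b + b.+3)%N by lia.
case/(_ charK0 pq) => A [w [y [z [u [v [Lbc L0 Ld]]]]]].
have rE : (#|A| + #|~: A| = r)%N by rewrite cardsC card_ord.
have := Ld _ _ pq; rewrite eqxx /= => Lpq.
(* Each power without x supplies one of the two extra units. With none, y^(b+1) and y^(b+1) z are
   both extra, paired with each other through y^(d-1) z; with exactly one, y^(b+1) is still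
   extra. *)
case: (ltngtP #|~: A| 1) => cA.
- have A0 : ~: A = set0 by apply/eqP; rewrite -cards_eq0; lia.
  rewrite -rE A0 cards0 addn0.
  apply: (card_ge_of_moments (p := fun=> b.+1) (q := fun i => (1 - i)%N) Lbc L0).
  move=> i lt_i2; split; [by [] | lia |].
  move: Lpq; rewrite A0 big_set0 addr0 => /negbT.
  by rewrite addSnnS subnKC.
- have : (b.+1 * b.+3 + 0 <= #|A|)%N.
    exact: (card_ge_of_moments (p := id) (q := id) Lbc L0).
  lia.
have /eqP/cards1P [i0 Ai0] := cA.
(* Otherwise a single power (u y + v z)^d would have no coefficient at y^d but
   a nonzero one at y^(d-1) z. *)
have [p [q [ltp pqE Lpq0]]] : exists p q, [/\ (b < p)%N, (p + q + 0 = b.+2)%N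
    & moment (mem A) w y z (b.+1 + p) (0 + q) != 0].
  have [Lp0|] := eqVneq (moment (mem A) w y z (b.+1 + b.+2) 0) 0; last first.
    by exists b.+2, 0%N; rewrite !addn0.
  exists b.+1, 1%N; split; [by [] | lia |]; rewrite addSnnS.
  apply: contraFneq Lpq => ->.
  have := Ld (b.+1 + b.+2)%N 0%N; rewrite Lp0 Ai0 !big_set1 !add0r.
  rewrite addn0 xpair_eqE andbF expr0 mulr1 => /(_ (addSnnS _ _)).
  by rewrite expf_eq0 => /andP[_ /eqP ->]; rewrite addnS expr0n mul0r.
rewrite -rE cA -[2%N]/(1 + 1)%N addnA leq_add2r.
by apply: (card_ge_of_moments (p := fun=> p) (q := fun=> q) Lbc L0) => -[].
Qed.

Lemma high_rank_form_exists (K : fieldType) d :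
  [pchar K] =i pred0 -> (2 <= d)%N ->
  exists2 F : {mpoly K[3]}, F \is d.-homog &
    forall r, sum_of_powers d F r -> ((d ^ 2 + 2 * d + 5) %/ 4 <= r)%N.
Proof.
move=> charK0 hd.
(* The bound equals (b+1)(b+2) + 1 for d = 2b + 2 and (b+1)(b+3) + 2 for d = 2b + 3. *)
have [b [dE|dE]] : exists b, d = (b + b.+2)%N \/ d = (b + b.+3)%N.
  by exists (d./2.-1); lia.
- exists ('X_[mon3 1 b b.+1] + 'X_[mon3 0 (b + b.+2) 0]).
    by apply: rpredD; rewrite dhomogX /= mdeg_mon3; lia.
  move=> r; rewrite dE => /(even_degree_rank_ge charK0).
  by apply: leq_trans; rewrite -ltnS ltn_divLR //; nia.
- exists ('X_[mon3 1 b b.+2] + 'X_[mon3 0 (b + b.+2) 1]).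
    by apply: rpredD; rewrite dhomogX /= mdeg_mon3; lia.
  move=> r; rewrite dE => /(odd_degree_rank_ge charK0).
  by apply: leq_trans; rewrite -ltnS ltn_divLR //; nia.
Qed.
Local Close Scope ring_scope.

Theorem theorem3 (K : closedFieldType) (charK0 : [pchar K]%R =i pred0)
    (d : nat) (hd : 2 <= d) :
  exists m : nat, is_rmax K 3 d m /\ (d ^ 2 + 2 * d + 5) %/ 4 <= m.
Proof.
have [m rm] := rmax_exists 3 charK0 (ltnW hd).
have [F hF le_rk] := high_rank_form_exists charK0 hd.
have [r [[Fr _] ler]] := proj2 rm F hF.
by exists m; split=> //; apply: leq_trans (le_rk r Fr) ler.
Qed.
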